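(* Let $\mathfrak{g}$ be a compact semisimple Lie algebra, $\mathfrak{h}$ a Lie subalgebra of $\mathfrak{g}$, and $\phi$ a finite-dimensional faithful complex representation of $\mathfrak{g}$. Then $\mathfrak{h}=\mathfrak{g}$ if and only if $\|(\phi\otimes\bar\phi)|_{\mathfrak{h}}\|_1=\|\phi\otimes\bar\phi\|_1$.
   Context: Representations are finite-dimensional complex matrix representations. $(\phi\otimes\psi)(g)=\phi(g)\otimes\mathbb 1+\mathbb 1\otimes\psi(g)$; the dual is $\bar\phi(g)=-\phi(g)^T$; $|_{\mathfrak{h}}$ denotes restriction. For a semisimple representation $\psi\cong\bigoplus_i\psi_i^{\oplus m_i}$ with pairwise inequivalent irreducible (over $\mathbb C$) $\psi_i$, $\|\psi\|_1=\sum_i m_i$. *)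

(* Defs.v *)
From HB Require Import structures.
From mathcomp Require Import all_boot all_order all_algebra.
From mathcomp Require Import complex mxtens.
From mathcomp Require Import boolp classical_sets reals.

Set Implicit Arguments.
Unset Strict Implicit.
Unset Printing Implicit Defensive.

Import Order.TTheory GRing.Theory Num.Theory.
Local Open Scope ring_scope.
Local Open Scope complex_scope.

Definition is_lie_bracket (R : realType) (V : vectType R) (br : V -> V -> V) :=
  [/\ (forall (a : R) (x y z : V), br (a *: x + y) z = a *: br x z + br y z),
      (forall (a : R) (x y z : V), br z (a *: x + y) = a *: br z x + br z y),
      (forall x : V, br x x = 0)
    & (forall x y z : V, br x (br y z) + br y (br z x) + br z (br x y) = 0)].

Definition lie_subalgebra (R : realType) (V : vectType R) (br : V -> V -> V)
    (h : {vspace V}) :=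
  forall x y, x \in h -> y \in h -> br x y \in h.

Definition lie_ideal (R : realType) (V : vectType R) (br : V -> V -> V)
    (I : {vspace V}) :=
  forall x y, y \in I -> br x y \in I.

(* Semisimple: no nonzero abelian ideal (equivalently, no nonzero solvable
   ideal). *)
Definition lie_semisimple (R : realType) (V : vectType R) (br : V -> V -> V) :=
  forall I : {vspace V}, lie_ideal br I ->
    (forall x y, x \in I -> y \in I -> br x y = 0) -> I = 0%VS.

Definition lie_compact (R : realType) (V : vectType R) (br : V -> V -> V) :=
  exists B : V -> V -> R,
    [/\ (forall (a : R) (x y z : V), B (a *: x + y) z = a * B x z + B y z),
        (forall x y, B x y = B y x),
        (forall x, x != 0 -> 0 < B x x)
      & (forall x y z, B (br x y) z + B y (br x z) = 0)].

Definition is_lie_rep (R : realType) (V : vectType R) (br : V -> V -> V)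
    (n : nat) (phi : V -> 'M[R[i]]_n) :=
  [/\ (forall (a : R) (x y : V), phi (a *: x + y) = a%:C *: phi x + phi y)
    & (forall x y, phi (br x y) = phi x *m phi y - phi y *m phi x)].

Definition faithful_rep (R : realType) (V : vectType R) (n : nat)
    (phi : V -> 'M[R[i]]_n) := injective phi.

Definition dual_rep (R : realType) (V : vectType R) (n : nat)
    (phi : V -> 'M[R[i]]_n) : V -> 'M[R[i]]_n :=
  fun x => - (phi x)^T.

Definition tensor_rep (R : realType) (V : vectType R) (n m : nat)
    (phi : V -> 'M[R[i]]_n) (psi : V -> 'M[R[i]]_m) : V -> 'M[R[i]]_(n * m) :=
  fun x => phi x *t (1%:M : 'M[R[i]]_m) + (1%:M : 'M[R[i]]_n) *t psi x.

(* Subspaces of C^N are represented, as in mxalgebra, by row spaces of      *)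
(* matrices; the column vector v lies in the subspace U iff (v^T <= U)%MS.  *)
(* U is invariant under A (acting on column vectors) iff U A^T <= U.        *)

Definition rep_invariant (R : realType) (V : vectType R) (S : {vspace V})
    (N : nat) (psi : V -> 'M[R[i]]_N) (U : 'M[R[i]]_N) :=
  forall x, x \in S -> (U *m (psi x)^T <= U)%MS.

Definition rep_irreducible_sub (R : realType) (V : vectType R) (S : {vspace V})
    (N : nat) (psi : V -> 'M[R[i]]_N) (U : 'M[R[i]]_N) :=
  [/\ rep_invariant S psi U, U != 0
    & forall W : 'M[R[i]]_N, rep_invariant S psi W -> (W <= U)%MS ->
        W == 0 \/ (W == U)%MS].

Definition has_irr_decomp (R : realType) (V : vectType R) (S : {vspace V})
    (N : nat) (psi : V -> 'M[R[i]]_N) (k : nat) :=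
  exists U : 'I_k -> 'M[R[i]]_N,
    [/\ forall i, rep_irreducible_sub S psi (U i),
        mxdirect (\sum_(i < k) U i)
      & (\sum_(i < k) U i :=: 1%:M)%MS].

(* ||psi|_S||_1 : the number k of irreducible summands (counted with
   multiplicity) in a decomposition psi|_S = (+)_i psi_i^{m_i},
   i.e. sum_i m_i.  (For a semisimple representation this number exists and
   is independent of the decomposition; otherwise the value 0 is a junk
   default.) *)
Definition norm1 (R : realType) (V : vectType R) (S : {vspace V})
    (N : nat) (psi : V -> 'M[R[i]]_N) : nat :=
  xget 0%N [set k | has_irr_decomp S psi k].

(* Main.v *)
Require Import Defs.
From HB Require Import structures.
From mathcomp Require Import all_boot all_order all_algebra spectral.
From mathcomp Require Import complex mxtens.
From mathcomp Require Import boolp classical_sets reals ring lra.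

(** If [g] and [h] decompose the representation into the same number of
    irreducibles then, comparing lengths, each [g]-irreducible summand [U i] is
    still irreducible under [h]. An [h]-invariant component in [U i] then spans
    it, so [g] acts trivially on it, [g] being perfect: [phi h] and [phi g] have
    the same commutant. Moreover the Casimir of [h] acts by a scalar on each
    [U i], hence commutes with [g]; read on matrices [Y], this says that
    [Y |-> \sum_i phi (e i) *m Y *m phi (e i)] commutes with [ad (phi x)] for
    [x] in [g], where [e] is an orthonormal basis of [h]. Since [phi] stays
    injective on the complexification of [g], one may pair the resulting tensor
    identity with [z] orthogonal to [h], and obtains [[x, w] _|_ z] for all [w]
    in [h]. So [z] commutes with [h], hence with [g], and [z = 0].

    The decomposition under [g] exists by Weyl's theorem. On an irreducible
    representation the eigenvalues of [phi x] have a common real part, because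
    [ad x] has imaginary spectrum; it vanishes as the trace does. Hence
    [\tr (phi x ^+ 2) <= 0], with equality only if [phi x = 0], and a Casimir
    operator of square zero forces the representation to be zero. Projectors
    can then be averaged by splitting off the image of the Casimir. *)

Set Implicit Arguments.
Unset Strict Implicit.
Unset Printing Implicit Defensive.

Import Order.TTheory GRing.Theory Num.Theory.
Local Open Scope ring_scope.


(** * Stable subspaces and length *)

Section StableSubspaces.
Variables (F : fieldType) (N : nat).
Implicit Types (G : 'M[F]_N -> Prop) (U W X : 'M[F]_N).

(** Matrices act on row spaces from the right. [G] is only a set of matrices, so an algebra and a
    subalgebra are compared by inclusion of their images. *)
Definition gstable G U := forall A, G A -> (U *m A <= U)%MS.

Definition girreducible G U :=
  [/\ gstable G U, U != 0
    & forall W, gstable G W -> (W <= U)%MS -> W == 0 \/ (W == U)%MS].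

Definition girr_decomp G k (U : 'I_k -> 'M[F]_N) W :=
  [/\ forall i, girreducible G (U i),
      mxdirect (\sum_(i < k) U i) & (\sum_(i < k) U i :=: W)%MS].

Lemma gstable1 G : gstable G 1%:M.
Proof. by move=> A _; rewrite submx1. Qed.

Lemma gstable_adds G U W : gstable G U -> gstable G W -> gstable G (U + W)%MS.
Proof.
by move=> sU sW A GA; rewrite addsmxMr addsmxS ?sU ?sW.
Qed.

Lemma gstable_cap G U W : gstable G U -> gstable G W -> gstable G (U :&: W)%MS.
Proof.
move=> sU sW A GA; rewrite sub_capmx.
rewrite (submx_trans (submxMr _ (capmxSl _ _)) (sU A GA)).
by rewrite (submx_trans (submxMr _ (capmxSr _ _)) (sW A GA)).
Qed.

Lemma gstable_sums G (I : finType) (P : pred I) (U : I -> 'M[F]_N) :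
  (forall i, P i -> gstable G (U i)) -> gstable G (\sum_(i | P i) U i)%MS.
Proof.
move=> sU A GA; rewrite sumsmxMr; apply/sumsmx_subP => i Pi.
exact: submx_trans (sU i Pi A GA) (sumsmx_sup i _ _).
Qed.

Lemma girreducible_exists G W : gstable G W -> W != 0 ->
  exists2 U, girreducible G U & (U <= W)%MS.
Proof.
elim: {W}_.+1 {-2}W (ltnSn (\rank W)) => // r IH W; rewrite ltnS => rW sW W0.
have [irrW|] := pselect (girreducible G W); first by exists W.
move=> nirr.
have [X [sX XW X0 nXW]] : exists X, [/\ gstable G X, (X <= W)%MS, X != 0 &
    ~~ (X == W)%MS].
  apply: contrapT => nX; apply: nirr; split=> // X sX XW.
  have [->|X0] := eqVneq X 0; first by left.
  right; apply: contrapT => /negP nXW; apply: nX; by exists X.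
have rX : (\rank X < \rank W)%N.
  rewrite ltn_neqAle mxrankS // andbT; apply: contraNneq nXW => e.
  by rewrite -(geq_leqif (mxrank_leqif_eq XW)) e.
have [|U irrU UX] := IH X _ sX X0; first exact: leq_trans rX rW.
by exists U => //; apply: submx_trans XW.
Qed.

Definition greducible G := forall U, gstable G U ->
  exists W, [/\ gstable G W, (U + W :=: 1%:M)%MS & (U :&: W = 0)%MS].

(** An irreducible [U] is split off [W]: by the modular law, a stable complement of [U] in the whole
    space meets [W] in a stable complement of [U] in [W], of smaller rank. *)
Lemma girr_decomp_exists G W : greducible G -> gstable G W ->
  exists k (U : 'I_k -> 'M[F]_N), girr_decomp G U W.
Proof.
move=> red; elim: {W}_.+1 {-2}W (ltnSn (\rank W)) => // r IH W.
rewrite ltnS => rW sW.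
have [W0|W0] := eqVneq W 0.
  exists 0, (fun=> 0); split; first by case.
    by rewrite mxdirectE /= !big_ord0 mxrank0.
  by rewrite big_ord0 W0.
have [U irrU UW] := girreducible_exists sW W0.
have [sU U0 _] := irrU.
have [X [sX sUX cUX]] := red U sU.
have eW : (U + (X :&: W) :=: W)%MS.
  apply: eqmx_trans (matrix_modl _ UW) _.
  by apply/eqmxP; rewrite capmxSr sub_capmx submx_refl sUX submx1.
have cW : (U :&: (X :&: W) = 0)%MS.
  by apply/eqP; rewrite -submx0 -cUX capmxS // capmxSl.
have rkW : \rank W = (\rank U + \rank (X :&: W)%MS)%N.
  by rewrite -mxrank_sum_cap cW mxrank0 addn0 eW.
have [| |k [Y [irrY dY eY]]] := IH (X :&: W)%MS.
- by rewrite (leq_trans _ rW) // rkW -[X in (X < _)%N]add0n ltn_add2r lt0n mxrank_eq0.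
- exact: gstable_cap.
exists k.+1, (fun i => oapp Y U (unlift ord0 i)).
have eS : (\sum_(i < k.+1) oapp Y U (unlift ord0 i) :=: U + \sum_(i < k) Y i)%MS.
  rewrite big_ord_recl unlift_none /=.
  by under eq_bigr => j _ do rewrite [unlift _ _]liftK /=.
split.
- by move=> i; case: unliftP => [j|] _ //=.
- rewrite mxdirectE /= eS big_ord_recl unlift_none /=.
  under [X in _ == (_ + X)%N]eq_bigr => j _ do rewrite liftK /=.
  move: dY; rewrite mxdirectE /= => /eqP <-.
  rewrite -(mxrank_sum_cap U) (cap_eqmx (eqmx_refl U) eY).
  by rewrite cW mxrank0 addn0.
- by apply: eqmx_trans eS (eqmx_trans (adds_eqmx (eqmx_refl _) eY) eW).
Qed.


(** * Length of stable subspaces, measured along a composition series *)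

Section JordanHolder.
Variables (G : 'M[F]_N -> Prop) (k : nat) (Y : 'I_k -> 'M[F]_N).
Hypothesis irrY : girr_decomp G Y 1%:M.

(** A composition series of the whole space, with successive quotients isomorphic to the [Y j]. *)
Let E j := (\sum_(i < k | (i < j)%N) Y i)%MS.

Lemma flag0 : E 0 = 0.
Proof. by rewrite /E big_pred0. Qed.

Lemma flag_all : (E k :=: 1%:M)%MS.
Proof.
have [_ _ eY] := irrY; apply: eqmx_trans eY.
have -> // : E k = (\sum_i Y i)%MS by apply: eq_bigl => i; rewrite ltn_ord.
Qed.

Lemma flagS (j : 'I_k) : (E j.+1 :=: E j + Y j)%MS.
Proof.
suff -> : E j.+1 = (E j + Y j)%MS by [].
rewrite /E (bigD1 j) //= addsmxC; congr (_ + _)%MS.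
by apply: eq_bigl => i; rewrite ltnS andbC -ltn_neqAle.
Qed.

Lemma gstable_flag j : gstable G (E j).
Proof. by apply: gstable_sums => i _; have [/(_ i)[]] := irrY. Qed.

(* The steps of the flag at which [W] grows; they compute the length of [W]. *)
Definition jumps W := [set j : 'I_k | ~~ (W :&: E j.+1 <= E j)%MS].

Lemma jumps_proper U W : gstable G U -> gstable G W -> (U <= W)%MS ->
  ~~ (W <= U)%MS -> (jumps U \proper jumps W)%SET.
Proof.
move=> sU sW UW; apply: contraNT => nprop.
have sub : jumps U \subset jumps W.
  apply/fintype.subsetP => j; rewrite !inE; apply: contraNN => /(submx_trans _); apply.
  exact: capmxS.
have eJ : jumps U = jumps W.
  by apply/eqP; rewrite finset.eqEsubset sub; move: nprop; rewrite properE sub negbK.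
(* Equal jumps would force [W] into [U], by climbing the flag. *)
have H j : (j <= k)%N -> (W :&: E j <= U)%MS.
  elim: j => [|j IH] jk; first by rewrite flag0 capmx0 sub0mx.
  have {}IH := IH (ltnW jk); pose j' := Ordinal jk.
  have [|] := boolP (j' \in jumps W); last first.
    rewrite inE negbK /= => Wj; apply: submx_trans IH.
    by rewrite sub_capmx capmxSl.
  rewrite -eJ inE /= => nUj.
  have [irr _ _] := irrY; have [sY Y0 minY] := irr j'.
  (* [X] lies between [E j] and [E j.+1]; by minimality of [Y j'] it is one of the two, and the jump
     of [U] at [j] excludes the first. *)
  pose X := (U :&: E j.+1 + E j)%MS.
  have sX : gstable G X.
    by apply: gstable_adds (gstable_flag _); apply: gstable_cap => //; apply: gstable_flag.
  have EX : (E j.+1 <= X)%MS.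
    have XE : (X <= E j.+1)%MS.
      by rewrite addsmx_sub capmxSr (flagS j') addsmxSl.
    have [/eqP c0|/eqmxP c1] := minY (X :&: Y j')%MS (gstable_cap sX sY) (capmxSr _ _).
      case/negP: nUj; apply: submx_trans (addsmxSl _ (E j)) _; rewrite -/X.
      have EjX : (E j <= X)%MS by rewrite addsmxSr.
      have : (X <= (E j + Y j') :&: X)%MS by rewrite sub_capmx submx_refl -(flagS j') XE.
      by move/submx_trans; apply; rewrite -(matrix_modl _ EjX) capmxC c0 addsmx0_id.
    by rewrite (flagS j') addsmx_sub addsmxSr -c1 capmxSl.
  have : (W :&: E j.+1 <= (U :&: E j.+1 + E j) :&: W)%MS.
    by rewrite sub_capmx capmxSl (submx_trans (capmxSr _ _) EX).
  move/submx_trans; apply; rewrite -matrix_modl; last first.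
    exact: submx_trans (capmxSl _ _) UW.
  by rewrite addsmx_sub capmxSl capmxC.
have := H k (leqnn k); apply: submx_trans; rewrite sub_capmx submx_refl.
by rewrite flag_all submx1.
Qed.

Lemma card_jumps_lt U W : gstable G U -> gstable G W -> (U <= W)%MS ->
  ~~ (W <= U)%MS -> (#|jumps U| < #|jumps W|)%N.
Proof. by move=> *; apply: proper_card; apply: jumps_proper. Qed.

End JordanHolder.

(* Inserting a proper stable subspace of some [U i] in the flag of the partial
   sums of [U] would give a chain of length [k + 1]. *)
Lemma girr_decomp_restrict G G' k (Y U : 'I_k -> 'M[F]_N) :
  (forall A, G A -> G' A) -> girr_decomp G Y 1%:M -> girr_decomp G' U 1%:M ->
  girr_decomp G U 1%:M.
Proof.
move=> GG' dY [irrU dU eU]; split=> // i0.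
have sU i : gstable G (U i) by move=> A /GG'; have [+ _ _] := irrU i; apply.
have [_ U0 _] := irrU i0; split=> // X sX XU.
apply: contrapT => nX.
pose C j := (\sum_(i < k | (i < j)%N) U i)%MS.
have sC j : gstable G (C j) by apply: gstable_sums.
have CS (j : 'I_k) : (C j.+1 :=: C j + U j)%MS.
  suff -> : C j.+1 = (C j + U j)%MS by [].
  rewrite /C (bigD1 j) //= addsmxC; congr (_ + _)%MS.
  by apply: eq_bigl => i; rewrite ltnS andbC -ltn_neqAle.
have dC (j : 'I_k) : (C j :&: U j = 0)%MS.
  move/mxdirect_sumsP: dU => /(_ j isT) dUj; apply/eqP; rewrite -submx0 -dUj.
  rewrite capmxC capmxS //; apply/sumsmx_subP => i ij.
  by rewrite (sumsmx_sup i) //= neq_ltn ij.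
have XnU : ~~ (U i0 <= X)%MS.
  by apply/negP => UX; apply: nX; right; rewrite XU UX.
have X0 : X != 0 by apply/eqP => X0; apply: nX; left; rewrite X0.
(* The term [(i0 < j)] counts the step [C i0 + X] inserted between [C i0] and [C i0.+1]. At [j = k]
   there would be [k + 1] jumps among [k] indices. *)
have bound (j : nat) : (j <= k)%N -> (j + (i0 < j) <= #|jumps Y (C j)|)%N.
  elim: j => // j IH jk; have {}IH := IH (ltnW jk); pose j' := Ordinal jk.
  have lt1 : (#|jumps Y (C j)| < #|jumps Y (C j.+1)|)%N.
    apply: (card_jumps_lt dY) => //; first by rewrite (CS j') addsmxSl.
    rewrite (CS j') addsmx_sub submx_refl /=; apply/negP => UC.
    have [_ /negP[]] := irrU j'; rewrite -submx0 -(dC j') sub_capmx UC.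
    by rewrite submx_refl.
  have [ltj|gtj|ej] := ltngtP i0 j.
  - by move: IH; rewrite ltj ltnS (ltnW ltj) !addn1 => /leq_ltn_trans; apply.
  - by move: IH; rewrite [(i0 < j.+1)%N]ltnS [(i0 <= j)%N]leqNgt gtj [(i0 < j)%N]ltnNge (ltnW gtj) !addn0 => /leq_ltn_trans; apply.
  - have ei : j' = i0 by apply: val_inj.
    move: IH; rewrite ej ltnn ltnSn addn0 addn1 => /leq_ltn_trans.
    have lt2 : (#|jumps Y (C j)| < #|jumps Y (C j + X)%MS|)%N.
      apply: (card_jumps_lt dY) => //; first exact: gstable_adds.
        exact: addsmxSl.
      rewrite addsmx_sub submx_refl /=; apply: contraNN X0 => XC.
      by rewrite -submx0 -(dC j') sub_capmx XC ei.
    move/(_ _ lt2)/leq_ltn_trans; apply; apply: (card_jumps_lt dY) => //.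
    + exact: gstable_adds.
    + by rewrite (CS j') addsmxS // ei.
    rewrite (CS j') addsmx_sub addsmxSl /= ei; apply: contraNN XnU => UCX.
    have : (U i0 <= (X + C j) :&: U i0)%MS by rewrite sub_capmx submx_refl addsmxC UCX.
    by rewrite -matrix_modl // -ei (dC j') addsmx0_id.
have := bound k (leqnn k); rewrite ltn_ord addn1 ltnNge.
by rewrite -[X in (_ <= X)%N]card_ord max_card.
Qed.

End StableSubspaces.


(** * Spectrum *)

Section ImaginarySpectrum.
Variable (C : numClosedFieldType).

(** [A *m A] is similar to a diagonal matrix with entries [- 'Im (d 0 j) ^+ 2], all real and
    nonpositive. *)
Lemma tr_sqr_imaginary n (A P : 'M[C]_n) (d : 'rV[C]_n) :
  P \in unitmx -> P *m A = diag_mx d *m P -> (forall j, 'Re (d 0 j) = 0) ->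
  \tr (A *m A) <= 0 /\ (\tr (A *m A) = 0 -> A = 0).
Proof.
move=> Pu PA dIm.
have eA : A = invmx P *m diag_mx d *m P by rewrite -mulmxA -PA mulKmx.
have eAA : A *m A = invmx P *m (diag_mx d *m diag_mx d) *m P.
  by rewrite {1}eA -!mulmxA PA.
have tE : \tr (A *m A) = - \sum_j 'Im (d 0 j) ^+ 2.
  rewrite eAA -mulmxA mxtrace_mulC -mulmxA mulmxV // mulmx1 /mxtrace -sumrN.
  apply: eq_bigr => j _; rewrite mul_diag_mx !mxE eqxx mulr1n.
  by rewrite {1 2}[d 0 j]Crect dIm add0r mulrACA -expr2 sqrCi mulN1r.
have sq0 j : true -> 0 <= 'Im (d 0 j) ^+ 2.
  by move=> _; rewrite real_exprn_even_ge0 // Creal_Im.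
split; first by rewrite tE oppr_le0 sumr_ge0.
move/eqP; rewrite tE oppr_eq0 psumr_eq0 // => /allP d0.
suff d_0 : d = 0 by rewrite eA d_0 linear0 mulmx0 mul0mx.
apply/rowP=> j; have := d0 j (mem_index_enum j).
rewrite implyTb expf_eq0 /= => /eqP dj.
by rewrite mxE [LHS]Crect dIm dj mulr0 add0r.
Qed.

(* The [Z k] shift the spectrum of [A] by imaginary numbers, so the sum of the
   eigenspaces of [A] for the eigenvalues with a given real part is stable. *)
Lemma irreducible_tr_sqr n m (A : 'M[C]_n) (Z : 'I_m -> 'M[C]_n) (c : 'I_m -> C) :
  (forall k, Z k *m A - A *m Z k = c k *: Z k) -> (forall k, 'Re (c k) = 0) ->
  (forall U : 'M[C]_n, (forall k, (U *m Z k <= U)%MS) -> U != 0 ->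
     (U :=: 1%:M)%MS) ->
  \tr A = 0 -> \tr (A *m A) <= 0 /\ (\tr (A *m A) = 0 -> A = 0).
Proof.
case: n A Z => [|n] A Z cZ cIm irr trA.
  by rewrite [A]thinmx0 mul0mx linear0.
have [r def_r] := closed_field_poly_normal (char_poly A).
have eig_r a : eigenvalue A a -> a \in r.
  rewrite eigenvalue_root_char def_r rootZ ?root_prod_XsubC //.
  by rewrite lead_coef_eq0 monic_neq0 // char_poly_monic.
have [a0 a0P] := eigenvalue_closed A (ltn0Sn n).
pose rs := undup [seq a <- r | 'Re a == 'Re a0].
have mem_rs a : (a \in rs) = ('Re a == 'Re a0) && (a \in r).
  by rewrite mem_undup mem_filter.
have Wmem a : a \in rs -> {i : 'I_(size rs) | a = rs`_i}.
  by move=> ars; exists (Ordinal (etrans (index_mem a rs) ars)); rewrite /= nth_index.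
pose W := (\sum_(i < size rs) eigenspace A rs`_i)%MS.
have subW a : a \in rs -> (eigenspace A a <= W)%MS.
  by move=> /Wmem[i ->]; rewrite (sumsmx_sup i).
have W1 : (W :=: 1%:M)%MS.
  apply: irr => [k|]; last first.
    apply: contraNneq (a0P) => W0; rewrite -submx0 -W0 subW //.
    by rewrite mem_rs eqxx eig_r.
  rewrite sumsmxMr; apply/sumsmx_subP => i _.
  set a := rs`_i; have ars : a \in rs by rewrite mem_nth.
  have : (eigenspace A a *m Z k <= eigenspace A (a + c k))%MS.
    apply/eigenspaceP; rewrite -mulmxA.
    have -> : Z k *m A = A *m Z k + c k *: Z k by rewrite -cZ addrC subrK.
    have /eigenspaceP eA := submx_refl (eigenspace A a).
    by rewrite mulmxDr mulmxA eA -scalemxAl -scalemxAr -scalerDl.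
  have [->|ne0] := eqVneq (eigenspace A (a + c k)) 0.
    by rewrite submx0 => /eqP ->; rewrite sub0mx.
  move/submx_trans; apply; apply: subW; rewrite mem_rs eig_r // andbT.
  rewrite raddfD /= cIm addr0.
  by move: ars; rewrite mem_rs => /andP[].
(* As the eigenspaces for [rs] fill the space, the product of the ['X - a%:P] over [rs] annihilates
   [A]; hence the minimal polynomial divides it. *)
have eig_rs a : eigenvalue A a -> a \in rs.
  rewrite eigenvalue_root_min -root_prod_XsubC => ra.
  move: ra; rewrite -!dvdp_XsubCl => /dvdp_trans; apply; apply: mxminpoly_min.
  rewrite -[LHS]mul1mx; apply/eqP; rewrite -submx0 -(eqmxMr _ W1).
  rewrite sumsmxMr; apply/sumsmx_subP => i _; rewrite submx0.
  rewrite (big_rem rs`_i) ?mem_nth //= rmorphM /= mulmxA rmorphB /=.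
  by rewrite horner_mx_X horner_mx_C mulmx_ker mul0mx.
have [P Pu [D AD]] : exists2 P, P \in unitmx & exists D, P *m A = diag_mx D *m P.
  have /diagonalizablePeigen[P Pu /(diagonalizable_forLR Pu)[D AD]] :
      exists2 rs, uniq rs & (\sum_(r <- rs) eigenspace A r :=: 1%:M)%MS.
    exists rs; first exact: undup_uniq.
    by rewrite (big_nth 0) big_mkord.
  exists P => //; exists D; rewrite AD mxpoly.conjumx ?unitmx_inv // invmxK.
  by rewrite !mulmxA mulmxV // mul1mx.
have eigD j : eigenvalue A (D 0 j).
  apply/eigenvalueP; exists (row j P).
    by rewrite -row_mul AD mul_diag_mx; apply/rowP => i; rewrite !mxE.
  apply/eqP => rj0; have := mulmxK Pu (delta_mx 0 j : 'rV_n.+1).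
  rewrite -rowE rj0 mul0mx => /matrixP/(_ 0 j)/eqP.
  by rewrite !mxE !eqxx eq_sym oner_eq0.
have ReD j : 'Re (D 0 j) = 'Re a0.
  by move: (eig_rs _ (eigD j)); rewrite mem_rs => /andP[/eqP].
apply: (tr_sqr_imaginary Pu AD) => j; rewrite ReD.
(* The real part of the trace is [n.+1] times the common real part of the eigenvalues. *)
have : 'Re (\tr A) = 0 by rewrite trA raddf0.
have -> : \tr A = \tr (diag_mx D).
  by rewrite -[A](mulKmx Pu) AD mxtrace_mulC mulmxK.
rewrite mxtrace_diag raddf_sum /= (eq_bigr _ (fun j _ => ReD j)).
by rewrite sumr_const card_ord => /eqP; rewrite mulrn_eq0 => /eqP.
Qed.
End ImaginarySpectrum.


(** * Invariant forms *)

Section InvariantForm.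
Variables (R : realType) (V : vectType R) (br : V -> V -> V) (B : V -> V -> R).

(** The conditions of [lie_compact], for a fixed form. *)
Definition invariant_form :=
  [/\ (forall (a : R) (x y z : V), B (a *: x + y) z = a * B x z + B y z),
      (forall x y, B x y = B y x),
      (forall x, x != 0 -> 0 < B x x)
    & (forall x y z, B (br x y) z + B y (br x z) = 0)].

Hypothesis lieV : is_lie_bracket br.
Hypothesis ssV : lie_semisimple br.
Hypothesis formB : invariant_form.

Lemma brDl x y z : br (x + y) z = br x z + br y z.
Proof. by case: lieV => L _ _ _; have := L 1 x y z; rewrite !scale1r. Qed.
Lemma brZl a x y : br (a *: x) y = a *: br x y.
Proof.
have br0 : br 0 y = 0 by apply: (addIr (br 0 y)); rewrite -brDl !add0r.
by case: lieV => L _ _ _; have := L a x 0 y; rewrite br0 !addr0.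
Qed.
Lemma brC x y : br x y = - br y x.
Proof.
apply/eqP; rewrite -addr_eq0; apply/eqP.
case: lieV => L1 L2 L3 _; have := L3 (x + y).
have := L2 1 x y (x + y); rewrite !scale1r => ->; rewrite !brDl !L3 add0r addr0.
by rewrite addrC.
Qed.
Lemma brDr x y z : br z (x + y) = br z x + br z y.
Proof. by rewrite brC brDl opprD -!brC. Qed.
Lemma brZr a x y : br y (a *: x) = a *: br y x.
Proof. by rewrite brC brZl -scalerN -brC. Qed.
Lemma brxx x : br x x = 0. Proof. by case: lieV. Qed.
Lemma br0r x : br x 0 = 0.
Proof. by have := brZr 0 0 x; rewrite !scale0r. Qed.
Lemma br_sumr I r (P : pred I) F x :
  br x (\sum_(i <- r | P i) F i) = \sum_(i <- r | P i) br x (F i).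
Proof. exact: (big_morph (br x) (fun a b => brDr a b x) (br0r x)). Qed.

Lemma formC x y : B x y = B y x. Proof. by case: formB. Qed.
Lemma formDl x y z : B (x + y) z = B x z + B y z.
Proof. by case: formB => L _ _ _; have := L 1 x y z; rewrite scale1r mul1r. Qed.
Lemma form0l z : B 0 z = 0.
Proof. by apply: (addIr (B 0 z)); rewrite -formDl !add0r. Qed.
Lemma formZl a x z : B (a *: x) z = a * B x z.
Proof.
by case: formB => L _ _ _; have := L a x 0 z; rewrite form0l !addr0.
Qed.
Lemma formNl x z : B (- x) z = - B x z.
Proof. by rewrite -scaleN1r formZl mulN1r. Qed.
Lemma formDr x y z : B z (x + y) = B z x + B z y.
Proof. by rewrite !(formC z) formDl. Qed.
Lemma formZr a x z : B z (a *: x) = a * B z x.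
Proof. by rewrite !(formC z) formZl. Qed.
Lemma formNr x z : B z (- x) = - B z x.
Proof. by rewrite !(formC z) formNl. Qed.
Lemma form_suml I r (P : pred I) F z :
  B (\sum_(i <- r | P i) F i) z = \sum_(i <- r | P i) B (F i) z.
Proof. exact: (big_morph (B^~ z) (fun a b => formDl a b z) (form0l z)). Qed.
Lemma form_sumr I r (P : pred I) F z :
  B z (\sum_(i <- r | P i) F i) = \sum_(i <- r | P i) B z (F i).
Proof. by rewrite formC form_suml; apply: eq_bigr => i _; rewrite formC. Qed.
Lemma form_br x y z : B (br x y) z = - B y (br x z).
Proof. by apply/eqP; rewrite -addr_eq0; case: formB => _ _ _ ->. Qed.
Lemma form_eq0 x : (forall y, B y x = 0) -> x = 0.
Proof.
move=> Bx; apply/eqP; apply: contraTT isT => /= x0.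
by case: formB => _ _ /(_ x x0); rewrite Bx ltxx.
Qed.

(* A Parseval frame of [S]; for instance an orthonormal basis. *)
Definition is_frame (S : {vspace V}) m (e : 'I_m -> V) :=
  (forall i, e i \in S) /\ forall u, u \in S -> u = \sum_i B u (e i) *: e i.

(** Gram-Schmidt along a spanning list: [p] is the projection of [x] on the previous span, and the
    remainder [r] is normalised, or dropped when it vanishes. *)
Lemma frame_exists (S : {vspace V}) : exists m (e : 'I_m -> V), is_frame S e.
Proof.
suff [s [sS sP]] : exists s : seq V, (forall z, z \in s -> z \in S) /\
    forall u, u \in S -> u = \sum_(z <- s) B u z *: z.
  exists (size s), (tnth (in_tuple s)); split=> [i|u uS].
    by apply: sS; apply: mem_tnth.
  by rewrite {1}(sP u uS) big_tnth.
rewrite -(span_basis (vbasisP S)); elim: (tval _) => [|x X [s [sS sP]]].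
  exists [::]; split=> // u; rewrite span_nil memv0 => /eqP ->.
  by rewrite big_nil.
pose p := \sum_(z <- s) B x z *: z; pose r := x - p.
have pX : p \in <<X>>%VS.
  by rewrite /p big_seq; apply: memv_suml => z zs; rewrite memvZ // sS.
have rX : r \in <<x :: X>>%VS.
  rewrite span_cons; apply: memvB.
    exact: (subvP (addvSl _ _)) (memv_line x).
  exact: (subvP (addvSr _ _)) pX.
have XX z : z \in <<X>>%VS -> z \in <<x :: X>>%VS.
  by move=> zX; rewrite span_cons (subvP (addvSr _ _)).
have rorth z : z \in <<X>>%VS -> B z r = 0.
  move=> zX; rewrite /r formDr formNr /p form_sumr [X in B X _](sP z zX).
  rewrite form_suml; apply/eqP; rewrite subr_eq0; apply/eqP.
  by apply: eq_bigr => w _; rewrite formZl formZr mulrC (formC w).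
have dec u : u \in <<x :: X>>%VS -> exists2 v, v \in <<X>>%VS & exists c, u = v + c *: r.
  rewrite span_cons => /memv_addP[_ /vlineP[c ->] [v vX ->]].
  exists (v + c *: p); first by rewrite memvD ?memvZ.
  by exists c; rewrite -addrA -scalerDr addrC /r addrCA subrr addr0.
have [r0|r0] := eqVneq r 0.
  exists s; split=> [z /sS /XX //|u /dec[v vX [c ->]]].
  by rewrite r0 scaler0 addr0; apply: sP.
have rpos : 0 < B r r by case: formB => _ _ /(_ r r0).
pose k := Num.sqrt (B r r).
have k0 : k != 0 by rewrite sqrtr_eq0 -ltNge.
have kk : B r r = k ^+ 2 by rewrite sqr_sqrtr // ltW.
exists (k^-1 *: r :: s); split=> [z|u /dec[v vX [c ->]]].
  rewrite inE => /predU1P[->|/sS/XX //]; exact: memvZ.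
rewrite big_cons formDl formZr rorth // mulr0 add0r formZr formZl kk.
rewrite scalerA [RHS]addrC; congr (_ + _); last first.
  by congr (_ *: r); field.
rewrite {1}(sP v vX) big_seq [RHS]big_seq; apply: eq_bigr => z zs.
by rewrite formDl formZl [B r z]formC rorth ?sS // mulr0 addr0.
Qed.

(** A central element spans an abelian ideal. *)
Lemma central_eq0 u : (forall x, br x u = 0) -> u = 0.
Proof.
move=> cu; have : <[u]>%VS = 0%VS.
  apply: ssV => [x _ /vlineP[c ->]|_ _ /vlineP[c ->] /vlineP[d ->]].
    by rewrite brZr cu scaler0 mem0v.
  by rewrite brZr brZl cu !scaler0.
by move=> u0; apply/eqP; rewrite -memv0 -u0 memv_line.
Qed.

Lemma orth_proj (S : {vspace V}) x :
  exists2 y, y \in S & forall z, z \in S -> B z (x - y) = 0.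
Proof.
have [m [e [eS eP]]] := frame_exists S.
exists (\sum_i B x (e i) *: e i); first by apply: memv_suml => i _; rewrite memvZ.
move=> z zS; rewrite formDr formNr form_sumr [X in B X x](eP z zS) form_suml.
apply/eqP; rewrite subr_eq0; apply/eqP; apply: eq_bigr => i _.
by rewrite formZl formZr mulrC (formC x).
Qed.

(* Perfectness, in the form in which it is used: brackets span [V]. *)
Lemma lie_perfect (C : pzRingType) (f : R -> C) (W : lmodType C) (F : V -> W) :
  (forall a x y, F (a *: x + y) = f a *: F x + F y) ->
  (forall x y, F (br x y) = 0) -> forall x, F x = 0.
Proof.
move=> linF F0 x.
have [m [e [_ eP]]] := frame_exists fullv.
pose X := [seq br (e p.1) (e p.2) | p : 'I_m * 'I_m].
have brX y z : br y z \in <<X>>%VS.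
  rewrite (eP z (memvf z)) br_sumr memv_suml // => j _; rewrite brZr memvZ //.
  rewrite (eP y (memvf y)) brC memvN br_sumr memv_suml // => i _.
  rewrite brZr memvZ // brC memvN memv_span //; apply/fintype.imageP; by exists (i, j).
have F_0 : F 0 = 0.
  have := F0 0 0; by rewrite br0r.
have FD y z : F (y + z) = F y + F z.
  have := linF 1 y z; rewrite scale1r => ->; congr (_ + _).
  by have := linF 1 y 0; rewrite F_0 scale1r !addr0 => <-.
have FZ a y : F (a *: y) = f a *: F y by rewrite -[a *: y]addr0 linF F_0 addr0.
have [y yX xy] := orth_proj <<X>>%VS x.
(* The difference is orthogonal to all brackets, so by invariance of the form it is central. *)
have -> : x = y.
  apply/eqP; rewrite -subr_eq0; apply/eqP; apply: central_eq0 => z.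
  by apply: form_eq0 => w; apply/eqP; rewrite -oppr_eq0 -form_br xy.
rewrite (coord_span (X := in_tuple X) yX) (big_morph F FD F_0) big1 // => i _.
rewrite FZ; have /fintype.imageP[p _ ->] : X`_i \in X by rewrite mem_nth.
by rewrite F0 scaler0.
Qed.

End InvariantForm.


(** * Weyl's theorem *)

Section LinearAlgebra.
Variable F : fieldType.

(* [L] is invertible on its image, hence on [M] modulo its kernel. *)
Lemma fitting_lift d (L M : 'M[F]_d) (v : 'rV_d) :
  (M *m L <= M)%MS -> (forall w : 'rV_d, w *m L *m L = 0 -> w *m L = 0) ->
  (v *m L <= M)%MS -> exists2 y : 'rV_d, (y <= M)%MS & (v - y) *m L = 0.
Proof.
move=> ML L2 vM.
have cap0 : (M :&: kermx L :&: (M *m L) = 0)%MS.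
  apply/eqP; rewrite -submx0; apply/rV_subP => w.
  rewrite !sub_capmx => /andP[/andP[_ /sub_kermxP wL] /submxP[t wt]].
  have tML0 : t *m M *m L = 0 by apply: L2; rewrite -(mulmxA t) -wt.
  by rewrite wt mulmxA tML0 sub0mx.
have sub : (M :&: kermx L + M *m L <= M)%MS by rewrite addsmx_sub capmxSl.
have eq : (M <= M :&: kermx L + M *m L)%MS.
  rewrite -(geq_leqif (mxrank_leqif_sup sub)).
  by rewrite (mxrank_disjoint_sum cap0) addnC mxrank_mul_ker.
have /sub_addsmxP[[u1 u2] /= vE] := submx_trans vM eq.
exists (u2 *m M); first exact: submxMl.
apply: L2; rewrite mulmxBl vE mulmxA addrK -mulmxA.
have /sub_kermxP -> : (M :&: kermx L <= kermx L)%MS by exact: capmxSr.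
by rewrite mulmx0.
Qed.

(** The operator [Y |-> Y *m A - A *m Y] in the coordinates [mxvec]. With this sign, and operators
    acting on rows, it respects commutators. *)
Definition admx n (A : 'M[F]_n) : 'M[F]_(n * n) := lin_mulmxr A - lin_mulmx A.

Lemma mul_vec_admx n (A Y : 'M[F]_n) :
  mxvec Y *m admx A = mxvec (Y *m A - A *m Y).
Proof. by rewrite /admx mulmxBr !mul_vec_lin /= linearB. Qed.

Lemma eq_mul_mxvec n m (M1 M2 : 'M[F]_(n * n, m)) :
  (forall Y, mxvec Y *m M1 = mxvec Y *m M2) -> M1 = M2.
Proof.
move=> eqM; apply/row_matrixP => i; rewrite !rowE.
by have := eqM (vec_mx (delta_mx 0 i)); rewrite vec_mxK.
Qed.

Lemma admxD a n (A A' : 'M[F]_n) : admx (a *: A + A') = a *: admx A + admx A'.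
Proof.
apply: eq_mul_mxvec => Y; rewrite [RHS]mulmxDr -[in RHS]scalemxAr !mul_vec_admx -linearP.
congr mxvec; rewrite mulmxDr mulmxDl -scalemxAr -scalemxAl scalerBr.
by rewrite opprD addrACA.
Qed.

Lemma admxM n (A A' : 'M[F]_n) :
  admx (A *m A' - A' *m A) = admx A *m admx A' - admx A' *m admx A.
Proof.
apply: eq_mul_mxvec => Y; rewrite [RHS]mulmxBr !(mulmxA (mxvec Y)) !mul_vec_admx -linearB.
apply: (congr1 mxvec); rewrite !(mulmxBr, mulmxBl) !mulmxA.
move: (Y *m A *m A') (Y *m A' *m A) (A *m A' *m Y) (A' *m A *m Y) => M1 M2 M3 M4.
move: (A *m Y *m A') (A' *m Y *m A) => M5 M6.
by apply/matrixP => i j; rewrite !mxE; ring.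
Qed.

(* Spans the [Y] such that [P *m Y = 0] and [Y *m P = Y]: the maps killing the range
   of [P] and landing in it. *)
Definition projector_range n (P : 'M[F]_n) : 'M[F]_(n * n) :=
  lin_mulmx (1%:M - P) *m lin_mulmxr P.

Lemma projector_rangeP n (P Y : 'M[F]_n) : P *m P = P ->
  reflect (P *m Y = 0 /\ Y *m P = Y) (mxvec Y <= projector_range P)%MS.
Proof.
move=> PP; apply: (iffP idP) => [/submxP[t]|[PY YP]]; last first.
  apply/submxP; exists (mxvec Y).
  by rewrite mulmxA !mul_vec_lin /= mulmxBl mul1mx PY subr0 YP.
rewrite -[t]vec_mxK mulmxA !mul_vec_lin /= => /(can_inj mxvecK) ->.
by rewrite !mulmxA mulmxBr mulmx1 PP subrr !mul0mx -mulmxA PP.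
Qed.

End LinearAlgebra.

(** * Casimir operators, and traces on irreducible representations *)

Section Representations.
Variables (R : realType) (V : vectType R) (br : V -> V -> V) (B : V -> V -> R).
Hypothesis lieV : is_lie_bracket br.
Hypothesis ssV : lie_semisimple br.
Hypothesis formB : invariant_form br B.
Variables (C : numClosedFieldType) (f : {rmorphism R -> C}).
Hypothesis f_real : forall a, f a \is Num.real.

(* [f] is the inclusion of the reals into the field of scalars. *)
Definition is_rep_along n (rho : V -> 'M[C]_n) :=
  (forall a x y, rho (a *: x + y) = f a *: rho x + rho y) /\
  (forall x y, rho (br x y) = rho x *m rho y - rho y *m rho x).

Definition rep_range (S : {vspace V}) n (rho : V -> 'M[C]_n) A :=
  exists2 x, x \in S & A = rho x.

(** When [e] is a frame of a subalgebra, this is its Casimir operator with respect to [B]. *)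
Definition casimir m (e : 'I_m -> V) n (rho : V -> 'M[C]_n) :=
  \sum_i rho (e i) *m rho (e i).

Section OneRep.
Variables (n : nat) (rho : V -> 'M[C]_n).
Hypothesis repr : is_rep_along rho.

Lemma rep0 : rho 0 = 0.
Proof. by case: repr => _ H; have := H 0 0; rewrite (brxx lieV) subrr. Qed.
Lemma repD x y : rho (x + y) = rho x + rho y.
Proof. by case: repr => H _; have := H 1 x y; rewrite scale1r rmorph1 scale1r. Qed.
Lemma repZ a x : rho (a *: x) = f a *: rho x.
Proof. by case: repr => H _; have := H a x 0; rewrite rep0 !addr0. Qed.
Lemma rep_sum I r (P : pred I) (F : I -> V) :
  rho (\sum_(i <- r | P i) F i) = \sum_(i <- r | P i) rho (F i).
Proof. exact: (big_morph rho repD rep0). Qed.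
Lemma rep_br x y : rho (br x y) = rho x *m rho y - rho y *m rho x.
Proof. by case: repr. Qed.

Lemma rep_frame S m (e : 'I_m -> V) x : is_frame B S e -> x \in S ->
  rho x = \sum_i f (B x (e i)) *: rho (e i).
Proof.
by move=> [_ eP] xS; rewrite {1}(eP x xS) rep_sum; apply: eq_bigr => i _; rewrite repZ.
Qed.

(** The coefficients [b] of [[e i, x]] in the frame are skew by invariance of the form, and in the
    commutator they multiply an expression symmetric in [i] and [j]. *)
Lemma casimir_comm S m (e : 'I_m -> V) x : is_frame B S e ->
  lie_subalgebra br S -> x \in S ->
  casimir e rho *m rho x = rho x *m casimir e rho.
Proof.
move=> frE subS xS; apply/eqP; rewrite -subr_eq0; apply/eqP.
pose b i j := f (B (br (e i) x) (e j)).
have bC i j : b i j = - b j i.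
  rewrite /b -rmorphN; congr (f _).
  rewrite (brC lieV) (formNl formB) (form_br formB) opprK (formC formB).
  by rewrite (brC lieV) (formNl formB).
have ebr i : rho (e i) *m rho x - rho x *m rho (e i) = \sum_j b i j *: rho (e j).
  by rewrite -rep_br (rep_frame frE) //; apply: subS => //; case: frE.
rewrite /casimir mulmx_suml mulmx_sumr -sumrB.
transitivity (\sum_i \sum_j b i j *: (rho (e i) *m rho (e j))
              + \sum_i \sum_j b i j *: (rho (e j) *m rho (e i))).
  rewrite -big_split /=; apply: eq_bigr => i _.
  have -> : \sum_j b i j *: (rho (e i) *m rho (e j)) =
            rho (e i) *m \sum_j b i j *: rho (e j).
    by rewrite mulmx_sumr; apply: eq_bigr => j _; rewrite scalemxAr.
  have -> : \sum_j b i j *: (rho (e j) *m rho (e i)) =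
            (\sum_j b i j *: rho (e j)) *m rho (e i).
    by rewrite mulmx_suml; apply: eq_bigr => j _; rewrite scalemxAl.
  by rewrite -ebr mulmxBr mulmxBl !mulmxA addrA subrK.
rewrite [X in _ + X]exchange_big -big_split big1 //= => i _.
rewrite -big_split big1 //= => j _.
by rewrite (bC j i) scaleNr subrr.
Qed.

Lemma rep_tr0 x : \tr (rho x) = 0.
Proof.
apply: (lie_perfect lieV ssV formB (f := f) (W := C^o) (F := fun x => \tr (rho x))).
  by move=> a y z; case: repr => -> _; rewrite linearP.
by move=> y z; rewrite rep_br linearB /= mxtrace_mulC subrr.
Qed.

Lemma rep_eq0 : (forall x y, rho (br x y) = 0) -> forall x, rho x = 0.
Proof. by case: repr => H _; apply: (lie_perfect lieV ssV formB (f := f)). Qed.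

(** The matrix [a] of [ad x] in a frame is real and skew, so [H = 'i *: a] is Hermitian. The
    spectral theorem yields combinations [Z k] of the [rho (e i)] that are eigenvectors of the
    commutator with [rho x], for imaginary eigenvalues. *)
Lemma rep_irr_tr_sqr x : girreducible (rep_range fullv rho) 1%:M ->
  \tr (rho x *m rho x) <= 0 /\ (\tr (rho x *m rho x) = 0 -> rho x = 0).
Proof.
move=> [_ _ irr].
have [m [e frE]] := frame_exists formB fullv.
pose a := \matrix_(i, j) f (B (br x (e i)) (e j)).
pose H := 'i *: a; pose P := spectralmx H; pose D := spectral_diag H.
have skew i j : a i j = - a j i.
  by rewrite !mxE -rmorphN (form_br formB) (formC formB).
have Hherm : H \is hermsymmx.
  apply/eqP/matrixP => i j; rewrite expr0 scale1r !mxE rmorphM /= conjCi.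
  by rewrite conj_Creal ?f_real // mulNr -mulrN; congr (_ * _); have := skew i j; rewrite !mxE.
have Pu : P \in unitmx by exact: spectral_unit.
have PH : P *m H = diag_mx D *m P.
  by rewrite [in LHS](orthomx_spectralP (hermitian_normalmx Hherm)) -mulmxA mulKVmx.
have Dreal k : D 0 k \is Num.real.
  by have /mxOverP/(_ 0 k) := hermitian_spectral_diag_real Hherm.
pose Z k := \sum_i P k i *: rho (e i).
(* Inverting [P] recovers the [rho (e i)] from the [Z k], so a subspace stable under all [Z k] is a
   subrepresentation. *)
have rhoE i : rho (e i) = \sum_k invmx P i k *: Z k.
  under eq_bigr do rewrite scaler_sumr.
  rewrite exchange_big /= (bigD1 i) //= [X in _ + X]big1 => [|j ji].
    under eq_bigr do rewrite scalerA.
    rewrite -scaler_suml.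
    have := mulVmx Pu => /matrixP/(_ i i); rewrite !mxE eqxx => ->.
    by rewrite scale1r addr0.
  under eq_bigr do rewrite scalerA.
  rewrite -scaler_suml.
  have := mulVmx Pu => /matrixP/(_ i j); rewrite !mxE eq_sym (negPf ji) => ->.
  by rewrite scale0r.
apply: (irreducible_tr_sqr (Z := Z) (c := fun k => 'i * D 0 k)).
- move=> k; rewrite /Z mulmx_suml mulmx_sumr -sumrB.
  transitivity (- \sum_i \sum_j (P k i * a i j) *: rho (e j)).
    rewrite -sumrN; apply: eq_bigr => i _.
    rewrite -scalemxAl -scalemxAr -scalerBr -opprB scalerN -rep_br.
    rewrite (rep_frame frE (memvf _)) scaler_sumr; congr (- _).
    by apply: eq_bigr => j _; rewrite scalerA mxE.
  rewrite exchange_big -sumrN scaler_sumr; apply: eq_bigr => j _.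
  rewrite -scaler_suml -scaleNr scalerA; congr (_ *: _).
  have := PH => /matrixP/(_ k j); rewrite mul_diag_mx mxE [RHS]mxE => PHkj.
  rewrite -mulrA -PHkj mulr_sumr -sumrN; apply: eq_bigr => i _.
  by rewrite [H i j]mxE (mulrCA 'i (P k i)) (mulrA 'i 'i) -expr2 sqrCi mulN1r mulrN.
- by move=> k; rewrite ReMil // (Creal_ImP _ (Dreal k)) oppr0.
- move=> U sU U0; have [||U00|/eqmxP //] := irr U; rewrite ?submx1 //.
    move=> _ [y _ ->]; rewrite (rep_frame frE (memvf y)) mulmx_sumr summx_sub // => i _.
    rewrite -scalemxAr scalemx_sub // rhoE mulmx_sumr summx_sub // => k _.
    by rewrite -scalemxAr scalemx_sub.
  by rewrite U00 in U0.
- exact: rep_tr0.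
Qed.

(** The trace of the Casimir is a sum of nonpositive terms, which vanish only with the
    [rho (e i)]. *)
Lemma rep_irr_casimir m (e : 'I_m -> V) :
  girreducible (rep_range fullv rho) 1%:M -> casimir e rho = 0 ->
  forall i, rho (e i) = 0.
Proof.
move=> irr cas0 i; have [_] := rep_irr_tr_sqr (e i) irr; apply.
apply/eqP; rewrite -oppr_eq0; move: i.
have : \sum_i (- \tr (rho (e i) *m rho (e i))) == 0.
  by rewrite sumrN -raddf_sum -/(casimir e rho) cas0 raddf0 oppr0.
rewrite psumr_eq0 => [/allP H i|i _]; first exact: (H i (mem_index_enum i)).
by rewrite oppr_ge0; case: (rep_irr_tr_sqr (e i) irr).
Qed.

End OneRep.
End Representations.


(** * Complete reducibility by means of the Casimir operator *)

Section CompleteReducibility.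
Variables (R : realType) (V : vectType R) (br : V -> V -> V) (B : V -> V -> R).
Hypothesis lieV : is_lie_bracket br.
Hypothesis ssV : lie_semisimple br.
Hypothesis formB : invariant_form br B.
Variables (C : numClosedFieldType) (f : {rmorphism R -> C}).
Hypothesis f_real : forall a, f a \is Num.real.

Local Notation is_rep := (@is_rep_along R V br C f _).

(** Serves both for restriction to a stable subspace and for passage to the quotient: in each case
    the compression is multiplicative. *)
Lemma rep_conj n r (rho : V -> 'M[C]_n) (X : 'M_(r, n)) (Y : 'M_(n, r)) :
  is_rep rho ->
  (forall x y, X *m rho x *m Y *m (X *m rho y *m Y) = X *m rho x *m rho y *m Y) ->
  is_rep (fun x => X *m rho x *m Y).
Proof.
move=> repr H; split=> [a x y|x y].
  case: repr => -> _.
  by rewrite mulmxDr mulmxDl -scalemxAr -scalemxAl.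
by rewrite !H (rep_br repr) mulmxBr mulmxBl !mulmxA.
Qed.

Lemma submx_base n (U : 'M[C]_n) : exists r (X : 'M_(r, n)) (Y : 'M_(n, r)),
  [/\ (X :=: U)%MS, X *m Y = 1%:M
    & forall k (A : 'M_(k, n)), (A <= U)%MS -> A *m Y *m X = A].
Proof.
exists (\rank U), (row_base U), (pinvmx (row_base U)); split.
- exact: eq_row_base.
- by apply: mulmxVp; apply: row_base_free.
- by move=> k A AU; apply: mulmxKpV; rewrite eq_row_base.
Qed.

(** [Q] is the projection to the quotient by [U], and [P] a linear section of it. *)
Lemma quomx_base n (U : 'M[C]_n) : exists q (Q : 'M_(n, q)) (P : 'M_(q, n)),
  [/\ q = (n - \rank U)%N, P *m Q = 1%:M
    & forall k (A : 'M_(k, n)), A *m Q = 0 <-> (A <= U)%MS].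
Proof.
exists (\rank (cokermx U)), (col_base (cokermx U)), (pinvmx (col_base (cokermx U))).
split=> [||k A]; first exact: mxrank_coker.
  by apply: mulVpmx; apply: col_base_full.
rewrite submxE -[cokermx U in X in _ <-> X]mulmx_base mulmxA; split=> [->|/eqP].
  by rewrite mul0mx.
by move/(canRL (mulmxKp (row_base_free _))); rewrite mul0mx.
Qed.

Lemma casimir_conj n r (rho : V -> 'M[C]_n) (X : 'M_(r, n)) (Y : 'M_(n, r))
    m (e : 'I_m -> V) :
  (forall x y, X *m rho x *m Y *m (X *m rho y *m Y) = X *m rho x *m rho y *m Y) ->
  casimir e (fun x => X *m rho x *m Y) = X *m casimir e rho *m Y.
Proof.
move=> H; rewrite mulmx_sumr mulmx_suml; apply: eq_bigr => i _.
by rewrite H !mulmxA.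
Qed.

Section Frame.
Variables (m : nat) (e : 'I_m -> V).
Hypothesis frE : is_frame B fullv e.

Lemma subalgebra_full : lie_subalgebra br fullv.
Proof. by move=> x y _ _; apply: memvf. Qed.

Lemma casimirC n (rho : V -> 'M[C]_n) x : is_rep rho ->
  casimir e rho *m rho x = rho x *m casimir e rho.
Proof.
by move=> repr; apply: (casimir_comm lieV formB repr frE subalgebra_full); apply: memvf.
Qed.

(** The kernel of the Casimir is stable, hence zero or everything; either way, a Casimir of square
    zero vanishes. *)
Lemma rep_irr_casimir2 n (rho : V -> 'M[C]_n) : is_rep rho ->
  girreducible (rep_range fullv rho) 1%:M ->
  casimir e rho *m casimir e rho = 0 -> forall x, rho x = 0.
Proof.
move=> repr irr c2 x; set c := casimir e rho in c2.
have sK : gstable (rep_range fullv rho) (kermx c).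
  move=> _ [y _ ->]; apply/sub_kermxP.
  by rewrite -mulmxA -casimirC // mulmxA mulmx_ker mul0mx.
have c0 : c = 0.
  have [_ _ minI] := irr.
  have [/eqP k0|/eqmxP k1] := minI _ sK (submx1 _).
    have : (c <= kermx c)%MS by apply/sub_kermxP.
    by rewrite k0 submx0 => /eqP.
  have : (1%:M <= kermx c)%MS by rewrite k1.
  by move/sub_kermxP; rewrite mul1mx.
rewrite (rep_frame lieV repr frE (memvf x)) big1 // => i _.
by rewrite (rep_irr_casimir lieV ssV formB f_real repr irr c0) scaler0.
Qed.

(** Induction on the dimension: the Casimir still has square zero on an irreducible
    subrepresentation [U] and on the quotient by [U], so the action is trivial on both. *)
Lemma rep_casimir2_eq0 n (rho : V -> 'M[C]_n) : is_rep rho ->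
  casimir e rho *m casimir e rho = 0 -> forall x, rho x = 0.
Proof.
elim: {n}_.+1 {-2}n (ltnSn n) rho => // N IH n; rewrite ltnS => nN rho repr c2 x.
have [n0|n0] := posnP n.
  by move: (rho x); rewrite n0 => M; apply: thinmx0.
set G := rep_range fullv rho.
have [||U irrU _] := @girreducible_exists _ _ G 1%:M.
- exact: gstable1.
- by rewrite -mxrank_eq0 mxrank1 -lt0n.
have [sU U0 minU] := irrU.
have stU y : (U *m rho y <= U)%MS by apply: sU; exists y => //; apply: memvf.
have [r [X [Y [XU XY YX]]]] := submx_base U.
have fX : row_free X by apply/row_freeP; exists Y.
have stX y : (X *m rho y <= X)%MS by rewrite XU (eqmxMr _ XU) stU.
have XrY y : X *m rho y *m Y *m X = X *m rho y by rewrite YX // -XU.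
have Xid y z : X *m rho y *m Y *m (X *m rho z *m Y) =
    X *m rho y *m rho z *m Y by rewrite !mulmxA XrY.
have X0 y : X *m rho y = 0.
  rewrite -[LHS]XrY.
  rewrite (rep_irr_casimir2 (rho := fun y => X *m rho y *m Y)) ?mul0mx //.
  - exact: rep_conj.
  - split; first exact: gstable1.
      by rewrite -mxrank_eq0 mxrank1 -(eqP (fX : \rank X == r)) XU mxrank_eq0.
    move=> W sW _.
    have sWX : gstable G <<W *m X>>%MS.
      move=> _ [z _ ->]; rewrite (eqmxMr _ (genmxE _)) genmxE.
      have /submxMr-/(_ _ X) : (W *m (X *m rho z *m Y) <= W)%MS.
        by apply: sW; exists z => //; apply: memvf.
      by rewrite -(mulmxA W) XrY mulmxA.
    have WXU : (<<W *m X>> <= U)%MS by rewrite genmxE -XU submxMl.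
    have [/eqP w0|/eqmxP w1] := minU _ sWX WXU; [left|right].
      have : (W *m X <= <<W *m X>>)%MS by rewrite genmxE.
      by rewrite w0 submx0 => /eqP/(congr1 (mulmx^~ Y)); rewrite -mulmxA XY mulmx1 mul0mx => ->.
    have /submxP[D XD] : (X <= W *m X)%MS by rewrite XU -w1 genmxE.
    rewrite submx1 /=; have -> : 1%:M = D *m W; last exact: submxMl.
    by rewrite -XY {1}XD -!mulmxA XY mulmx1.
  - rewrite (casimir_conj _ Xid) mulmxA (mulmxA _ X).
    have : (X *m casimir e rho <= X)%MS.
      rewrite mulmx_sumr summx_sub // => i _; rewrite mulmxA.
      exact: submx_trans (submxMr _ (stX _)) (stX _).
    by rewrite XU => /YX ->; rewrite -(mulmxA X) c2 mulmx0 mul0mx.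
have [q [Q [P [qE PQ QP]]]] := quomx_base U.
have rhoQ y : Q *m (P *m rho y *m Q) = rho y *m Q.
  apply/eqP; rewrite eq_sym -subr_eq0 !mulmxA -mulmxBl -{1}[rho y]mul1mx -mulmxBl; apply/eqP.
  apply/QP; apply: submx_trans (submxMr _ _) (stU y); apply/QP.
  by rewrite mulmxBl mul1mx -mulmxA PQ mulmx1 subrr.
have Qid y z : P *m rho y *m Q *m (P *m rho z *m Q) = P *m rho y *m rho z *m Q.
  by rewrite -[LHS]mulmxA rhoQ !mulmxA.
have Q0 y : rho y *m Q = 0.
  rewrite -rhoQ (IH _ _ (fun y => P *m rho y *m Q)) ?mulmx0 //.
  - rewrite qE; apply: leq_trans nN; rewrite ltn_subrL n0 andbT.
    by rewrite lt0n mxrank_eq0.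
  - exact: rep_conj.
  - rewrite (casimir_conj _ Qid) -!mulmxA (mulmxA Q).
    have -> : Q *m P *m (casimir e rho *m Q) = casimir e rho *m Q.
      rewrite mulmx_suml mulmx_sumr; apply: eq_bigr => i _.
      have rhoQ' z : Q *m P *m (rho z *m Q) = rho z *m Q by rewrite -[RHS]rhoQ !mulmxA.
      rewrite -(mulmxA (rho (e i))) -rhoQ !(mulmxA (rho (e i)) Q).
      by rewrite (mulmxA (Q *m P)) rhoQ'.
    by rewrite (mulmxA (casimir e rho)) c2 mul0mx mulmx0.
(* [rho y] maps everything into [U] by [Q0], and [rho z] kills [U] by [X0]. All commutators
   therefore vanish, and perfectness concludes. *)
have rr0 y z : rho y *m rho z = 0.
  have /submxP[D ->] : (rho y <= X)%MS by rewrite XU; apply/QP.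
  by rewrite -mulmxA X0 mulmx0.
by apply: (rep_eq0 lieV ssV formB repr) => y z; rewrite (rep_br repr) !rr0 subrr.
Qed.

(** The kernel of the squared Casimir is a subrepresentation on which the Casimir has square zero,
    so the action on it is trivial. *)
Lemma ker_casimir2 n (rho : V -> 'M[C]_n) (v : 'rV_n) x : is_rep rho ->
  v *m casimir e rho *m casimir e rho = 0 -> v *m rho x = 0.
Proof.
move=> repr vc; set c := casimir e rho in vc.
have [r [X [Y [XU XY YX]]]] := submx_base (kermx (c *m c)).
have Xc : X *m (c *m c) = 0 by apply/sub_kermxP; rewrite XU.
have stX y : (X *m rho y <= X)%MS.
  rewrite XU; apply/sub_kermxP; rewrite mulmxA -(mulmxA X) -casimirC //.
  by rewrite mulmxA -(mulmxA _ (rho y)) -casimirC // !mulmxA -(mulmxA X) Xc mul0mx.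
have XrY y : X *m rho y *m Y *m X = X *m rho y by rewrite YX // -XU.
have Xid y z : X *m rho y *m Y *m (X *m rho z *m Y) =
    X *m rho y *m rho z *m Y by rewrite !mulmxA XrY.
have vX : (v <= X)%MS by rewrite XU; apply/sub_kermxP; rewrite mulmxA.
have /submxP[D ->] := vX.
rewrite -mulmxA -XrY.
rewrite (rep_casimir2_eq0 (rho := fun y => X *m rho y *m Y)) ?mul0mx ?mulmx0 //.
  exact: rep_conj.
rewrite (casimir_conj _ Xid) mulmxA (mulmxA _ X).
have : (X *m casimir e rho <= X)%MS.
  rewrite mulmx_sumr summx_sub // => i _; rewrite mulmxA.
  exact: submx_trans (submxMr _ (stX _)) (stX _).
by rewrite XU => /YX ->; rewrite -/c -(mulmxA X) Xc mul0mx.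
Qed.

End Frame.

Lemma rep_admx n (rho : V -> 'M[C]_n) : is_rep rho -> is_rep (fun x => admx (rho x)).
Proof.
move=> repr; split=> [a x y|x y]; first by case: repr => -> _; rewrite admxD.
by rewrite (rep_br repr) admxM.
Qed.

(** A projector [P] onto [U] is corrected to one commuting with the action. Its commutators lie in
    the stable space [M] of maps killing [U] and landing in [U]; since [L] and its square have the
    same kernel, some [Y] in [M] makes [P - Y] killed by [L], hence invariant. *)
Theorem weyl n (rho : V -> 'M[C]_n) : is_rep rho ->
  greducible (rep_range fullv rho).
Proof.
move=> repr U sU.
have [m [e frE]] := frame_exists formB fullv.
have stU x : (U *m rho x <= U)%MS by apply: sU; exists x => //; apply: memvf.
have [P PU subP] : exists2 P : 'M_n, (P <= U)%MS &
    forall k (A : 'M_(k, n)), (A <= U)%MS -> A *m P = A.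
  exists (pinvmx U *m U) => [|k A AU]; first exact: submxMl.
  by rewrite mulmxA mulmxKpV.
have PP : P *m P = P by exact: subP.
have PrP x : P *m rho x *m P = P *m rho x.
  by apply: subP; apply: submx_trans (submxMr _ PU) (stU x).
pose ad x := admx (rho x); have repA : is_rep ad by exact: rep_admx.
pose M := projector_range P; pose L := casimir e ad.
have stM x : (M *m ad x <= M)%MS.
  apply/row_subP => i; rewrite row_mul.
  have : (row i M <= M)%MS by exact: row_sub.
  rewrite -[row i M]vec_mxK => /(projector_rangeP _ PP)[PY YP].
  rewrite mul_vec_admx; apply/(projector_rangeP _ PP).
  move: (vec_mx _) PY YP => Y PY YP; split.
    by rewrite mulmxBr !mulmxA PY mul0mx -PrP -(mulmxA _ P) PY mulmx0 subrr.
  have YrP : Y *m rho x *m P = Y *m rho x.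
    by rewrite -[in RHS]YP -(mulmxA Y P) -PrP !mulmxA YP.
  by rewrite mulmxBl YrP -mulmxA YP.
have ML : (M *m L <= M)%MS.
  rewrite mulmx_sumr summx_sub // => i _; rewrite mulmxA.
  exact: submx_trans (submxMr _ (stM _)) (stM _).
have PM x : (mxvec P *m ad x <= M)%MS.
  rewrite mul_vec_admx; apply/(projector_rangeP _ PP); split.
    by rewrite mulmxBr !mulmxA PP PrP subrr.
  by rewrite mulmxBl PrP -mulmxA PP.
have PL : (mxvec P *m L <= M)%MS.
  rewrite mulmx_sumr summx_sub // => i _; rewrite mulmxA.
  exact: submx_trans (submxMr _ (PM _)) (stM _).
have L2 (w : 'rV_(n * n)) : w *m L *m L = 0 -> w *m L = 0.
  move=> wL; rewrite mulmx_sumr big1 // => i _.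
  by rewrite mulmxA (ker_casimir2 frE _ repA wL) mul0mx.
have [y yM yL] := fitting_lift ML L2 PL.
move: yM yL; rewrite -[y]vec_mxK; move: (vec_mx y) => Y.
move/(projector_rangeP _ PP) => [PY YP]; rewrite -linearB => YL.
(* [P0] is still a projector onto [U], because [Y] kills [U] and lands in it; its kernel is the
   stable complement. *)
pose P0 := P - Y.
have comm x : P0 *m rho x = rho x *m P0.
  apply/eqP; rewrite -subr_eq0; apply/eqP; apply: (can_inj mxvecK).
  rewrite -mul_vec_admx linear0; apply: (ker_casimir2 frE _ repA).
  by rewrite -/L -/ad YL mul0mx.
have P0U : (P0 <= U)%MS 
  by rewrite addmx_sub // eqmx_opp -YP; apply: submx_trans (submxMl _ _) PU.
have UP0 k (A : 'M_(k, n)) : (A <= U)%MS -> A *m P0 = A.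
  by move=> AU; rewrite mulmxBr subP // -{2}[A]subP // -mulmxA PY mulmx0 subr0.
exists (kermx P0); split.
- move=> _ [x _ ->]; apply/sub_kermxP.
  by rewrite -mulmxA -comm mulmxA mulmx_ker mul0mx.
- apply/eqmxP; rewrite submx1 /=.
  have -> : 1%:M = P0 + (1%:M - P0) by rewrite addrC subrK.
  rewrite addmx_sub_adds //; apply/sub_kermxP.
  by rewrite mulmxBl mul1mx UP0 // subrr.
- apply/eqP; rewrite -submx0; apply/rV_subP => w.
  by rewrite sub_capmx => /andP[/UP0 wP0 /sub_kermxP wk]; rewrite -wP0 wk sub0mx.
Qed.

End CompleteReducibility.


(** * Subalgebras *)

(** Schur's lemma: an eigenspace of [Z] is stable, and for an eigenvalue of [Z] on [U] it meets [U]
    nontrivially. *)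
Lemma girreducible_scalar (C : numClosedFieldType) n (G : 'M[C]_n -> Prop)
    (U Z : 'M_n) :
  girreducible G U -> (forall A, G A -> A *m Z = Z *m A) -> (U *m Z <= U)%MS ->
  exists c, U *m Z = c *: U.
Proof.
move=> [sU U0 minU] comm UZ.
have [r [X [Y [XU XY YX]]]] := submx_base U.
have r0 : (0 < r)%N.
  rewrite lt0n; apply: contraNneq U0 => r0; rewrite -mxrank_eq0 -XU.
  by rewrite -leqn0 -[X in (_ <= X)%N]r0 rank_leq_row.
have XZ : X *m Z *m Y *m X = X *m Z by apply: YX; rewrite (eqmxMr _ XU).
have [c /eigenvalueP[v vc v0]] := eigenvalue_closed (X *m Z *m Y) r0.
have wX : v *m X != 0.
  by apply: contraNneq v0 => w0; rewrite -[v]mulmx1 -XY mulmxA w0 mul0mx.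
have wE : (v *m X <= eigenspace Z c)%MS.
  by apply/eigenspaceP; rewrite -mulmxA -XZ mulmxA vc scalemxAl.
exists c; apply/eigenspaceP.
have sE : gstable G (eigenspace Z c).
  move=> A GA; apply/eigenspaceP; rewrite -mulmxA comm // mulmxA.
  by have /eigenspaceP -> := submx_refl (eigenspace Z c); rewrite scalemxAl.
have [/eqP c0|/eqmxP c1] := minU _ (gstable_cap sU sE) (capmxSl _ _).
  case/negP: wX; rewrite -submx0 -c0 sub_capmx wE andbT.
  by rewrite -XU submxMl.
by rewrite -c1 capmxSr.
Qed.

Lemma girr_decomp_commute (F : fieldType) n (G : 'M[F]_n -> Prop) k
    (U : 'I_k -> 'M_n) (c : 'I_k -> F) (Z : 'M_n) :
  girr_decomp G U 1%:M -> (forall i, U i *m Z = c i *: U i) ->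
  forall A, G A -> A *m Z = Z *m A.
Proof.
move=> [irrU _ eU] cU A GA; apply/eqP; rewrite -subr_eq0; apply/eqP.
have : (1%:M <= kermx (A *m Z - Z *m A))%MS.
  rewrite -eU; apply/sumsmx_subP => i _; apply/sub_kermxP.
  have [sU _ _] := irrU i; have /submxP[D UA] := sU A GA.
  by rewrite mulmxBr !mulmxA UA cU -mulmxA cU -scalemxAl -scalemxAr UA subrr.
by move/sub_kermxP; rewrite mul1mx.
Qed.

Section Invariants.
Variables (R : realType) (V : vectType R) (br : V -> V -> V) (B : V -> V -> R).
Hypothesis lieV : is_lie_bracket br.
Hypothesis ssV : lie_semisimple br.
Hypothesis formB : invariant_form br B.
Variables (C : numClosedFieldType) (f : {rmorphism R -> C}).
Hypothesis f_real : forall a, f a \is Num.real.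

(* A nonzero component in [U i] of an [h]-invariant vector spans [U i], so [g]
   acts on [U i] by scalars, which vanish because [g] is perfect. *)
Lemma invariants_restrict (h : {vspace V}) n (rho : V -> 'M[C]_n) k
    (U : 'I_k -> 'M_n) (v : 'rV_n) :
  is_rep_along br f rho -> girr_decomp (rep_range fullv rho) U 1%:M ->
  girr_decomp (rep_range h rho) U 1%:M ->
  (forall x, x \in h -> v *m rho x = 0) -> forall x, v *m rho x = 0.
Proof.
move=> repr [gU dU eU] [hU _ _] vh x.
have : (v <= \sum_i U i)%MS by rewrite eU submx1.
move/sub_sumsmxP => [u vE].
suff H i y : u i *m U i *m rho y = 0.
  by rewrite vE mulmx_suml big1 // => i _; apply: H.
have stU z : (U i *m rho z <= U i)%MS.
  by have [sU _ _] := gU i; apply: sU; exists z => //; apply: memvf.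
have stU' j z : (U j *m rho z <= U j)%MS.
  by have [sU _ _] := gU j; apply: sU; exists z => //; apply: memvf.
set w := u i *m U i.
have wh z : z \in h -> w *m rho z = 0.
  move=> zh; apply/eqP; rewrite -submx0.
  move/mxdirect_sumsP: dU => /(_ i isT) <-; rewrite sub_capmx.
  apply/andP; split; first by rewrite -mulmxA mulmx_sub.
  have := vh z zh; rewrite vE mulmx_suml (bigD1 i) //= -/w => /eqP.
  rewrite addr_eq0 => /eqP ->; rewrite eqmx_opp summx_sub // => j ji.
  by rewrite -mulmxA (sumsmx_sup j) // mulmx_sub.
have [->|w0] := eqVneq w 0; first by rewrite mul0mx.
have wU : (U i <= w)%MS.
  have [_ _ minU] := hU i.
  have sw : gstable (rep_range h rho) <<w>>%MS.
    by move=> _ [z zh ->]; rewrite (eqmxMr _ (genmxE w)) wh // sub0mx.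
  have wUi : (<<w>> <= U i)%MS by rewrite genmxE submxMl.
  have [g0|/eqmxP g1] := minU _ sw wUi.
    by case/negP: w0; rewrite -submx0 -(eqP g0) genmxE.
  by rewrite -g1 genmxE.
have scal z : exists c, w *m rho z = c *: w.
  by apply/sub_rVP; apply: submx_trans wU; rewrite -mulmxA mulmx_sub.
apply: (lie_perfect lieV ssV formB (f := f) (F := fun y => w *m rho y)).
  by move=> a y' z; case: repr => -> _; rewrite mulmxDr -scalemxAr.
move=> y' z; rewrite (rep_br repr) mulmxBr !mulmxA.
have [c wc] := scal y'; have [d wd] := scal z.
by rewrite wc wd -!scalemxAl wc wd !scalerA mulrC subrr.
Qed.

Variables (n : nat) (phi : V -> 'M[C]_n).
Hypothesis repr : is_rep_along br f phi.
Hypothesis inj_phi : injective phi.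
Variables re im : C -> R.
Hypothesis reim : forall c, c = f (re c) + 'i * f (im c).

(** The relation gives [(ad u)^2 = - (ad v)^2]. Paired with [x], it says that the squared norms of
    [[u, x]] and [[v, x]] sum to zero, so [u] and [v] are central. *)
Lemma faithful_complexification u v : phi u + 'i *: phi v = 0 -> u = 0 /\ v = 0.
Proof.
move=> uv; have uE : phi u = - 'i *: phi v by apply/eqP; rewrite scaleNr -addr_eq0 uv.
have brE x : br u (br u x) = - br v (br v x).
  apply: inj_phi; rewrite -scaleN1r (repZ lieV repr) rmorphN1.
  rewrite !(rep_br repr) uE -!scalemxAl -!scalemxAr -!scalerBr -!scalemxAl.
  by rewrite -!scalemxAr -scalerBr scalerA mulrNN -expr2 sqrCi.
have ge0 y : 0 <= B y y.
  have [->|y0] := eqVneq y 0; first by rewrite (form0l formB).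
  by case: formB => _ _ /(_ y y0) /ltW.
have eq0 y : B y y = 0 -> y = 0.
  move=> y0; apply/eqP; apply: contraTT isT => yn.
  by case: formB => _ _ /(_ y yn); rewrite y0 ltxx.
have H x : br u x = 0 /\ br v x = 0.
  have := congr1 (B^~ x) (brE x).
  rewrite (formNl formB) (form_br formB u) (form_br formB v) opprK => E.
  have E1 := ge0 (br u x); have E2 := ge0 (br v x).
  by split; apply: eq0; lra.
by split; apply: (central_eq0 lieV ssV) => x; rewrite (brC lieV);
  have [Hu Hv] := H x; rewrite ?Hu ?Hv oppr0.
Qed.

(** The map [Y |-> \sum_i A i *m Y *m B i] determines the tensor [\sum_i A i *t B i]. Freezing one
    factor at its entry [(b, q)] leaves a complex linear relation in the image of [phi], and pairing
    with [z] removes the terms in [e i]. *)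
Lemma tensor_form_eq0 m (e e' : 'I_m -> V) z :
  (forall Y, \sum_i (phi (e' i) *m Y *m phi (e i) + phi (e i) *m Y *m phi (e' i)) = 0) ->
  (forall i, B (e i) z = 0) -> \sum_i B (e' i) z *: e i = 0.
Proof.
move=> sum0 ez; apply: inj_phi; rewrite (rep0 lieV repr).
apply/matrixP => b q; rewrite [RHS]mxE (rep_sum lieV repr) summxE.
pose c i := phi (e i) b q; pose d i := phi (e' i) b q.
have cd : \sum_i (c i *: phi (e' i) + d i *: phi (e i)) = 0.
  (* A matrix unit [Y] separates the factors: [M *m Y *m N] has entry [M p a * N b q]. *)
  apply/matrixP => p a; pose Y : 'M[C]_n := delta_mx a b.
  have E : (\sum_i (phi (e' i) *m Y *m phi (e i) + phi (e i) *m Y *m phi (e' i))) p q = 0.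
    by rewrite sum0 mxE.
  rewrite [RHS]mxE; apply: etrans E; rewrite !summxE; apply: eq_bigr => i _.
  have dE (M N : 'M[C]_n) : (M *m Y *m N) p q = M p a * N b q.
    rewrite /Y -(mul_delta_mx (0 : 'I_1)) !mulmxA -colE -mulmxA -rowE mxE.
    by rewrite big_ord1 !mxE.
  by rewrite [RHS]mxE !dE !mxE mulrC [d i * _]mulrC.
(* [lin re] and [lin im] are the real and imaginary parts of the relation [cd], lifted to [V]. *)
pose lin r := \sum_i (r (c i) *: e' i + r (d i) *: e i).
have [u0 v0] : lin re = 0 /\ lin im = 0.
  apply: faithful_complexification; rewrite /lin !(rep_sum lieV repr) scaler_sumr.
  rewrite -big_split /= -[RHS]cd; apply: eq_bigr => i _.
  rewrite !(repD repr) !(repZ lieV repr) scalerDr !scalerA addrACA -!scalerDl.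
  by rewrite -!reim.
have B0 r : lin r = 0 -> \sum_i B (e' i) z * r (c i) = 0.
  move=> r0; have := congr1 (B^~ z) r0; rewrite (form_suml formB) (form0l formB).
  move=> {2}<-; apply: eq_bigr => i _.
  by rewrite (formDl formB) !(formZl formB) ez mulr0 addr0 mulrC.
under eq_bigr do rewrite (repZ lieV repr) mxE -/(c _) [c _]reim mulrDr mulrCA -!rmorphM.
by rewrite big_split /= -mulr_sumr -!rmorph_sum !B0 // rmorph0 mulr0 addr0.
Qed.

Lemma subalgebra_full_criterion (h : {vspace V}) m (e : 'I_m -> V) :
  lie_subalgebra br h -> is_frame B h e ->
  (forall Y, (forall w, w \in h -> Y *m phi w = phi w *m Y) ->
     forall x, Y *m phi x = phi x *m Y) ->
  (forall Y x, let ad M N := N *m M - M *m N in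
     \sum_i ad (phi (e i)) (ad (phi (e i)) (ad (phi x) Y)) =
     ad (phi x) (\sum_i ad (phi (e i)) (ad (phi (e i)) Y))) ->
  h = fullv.
Proof.
move=> subh frE inv cas.
have eh i : e i \in h by case: frE.
pose K := casimir e phi.
have Kx x : K *m phi x = phi x *m K.
  by apply: inv => w wh; apply: (casimir_comm lieV formB repr frE subh wh).
(* On matrices the Casimir of [h] is [Y |-> Y *m K + K *m Y - T Y *+ 2]. Since [K] commutes with
   [phi x], so does [T] with [D]; expanding [T (D Y) - D (T Y) = 0] gives the identity. *)
have T0 x Y : \sum_i (phi (br x (e i)) *m Y *m phi (e i)
                      + phi (e i) *m Y *m phi (br x (e i))) = 0.
  have adE Y' : \sum_i ((Y' *m phi (e i) - phi (e i) *m Y') *m phi (e i)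
       - phi (e i) *m (Y' *m phi (e i) - phi (e i) *m Y')) =
       Y' *m K + K *m Y' - (\sum_i phi (e i) *m Y' *m phi (e i)) *+ 2.
    rewrite /K /casimir mulmx_sumr mulmx_suml -sumrMnl -big_split -sumrB /=.
    apply: eq_bigr => i _; rewrite !(mulmxBr, mulmxBl) !mulmxA.
    by apply/matrixP => p q; rewrite !mxE; ring.
  pose D Z := Z *m phi x - phi x *m Z.
  pose T Z := \sum_i phi (e i) *m Z *m phi (e i).
  have DKr : D (Y *m K) = D Y *m K by rewrite /D mulmxBl -!mulmxA Kx.
  have DKl : D (K *m Y) = K *m D Y by rewrite /D mulmxBr !mulmxA Kx.
  have DD M N P : D (M + N - P *+ 2) = D M + D N - D P *+ 2.
    rewrite /D !mulr2n !(mulmxBl, mulmxDl, mulmxBr, mulmxDr).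
    by apply/matrixP => p q; rewrite !mxE; ring.
  have := cas Y x; rewrite /= !adE -/(T _) -/(T Y) -/(D Y).
  rewrite -[X in _ = X]/(D _) DD DKr DKl => /addrI/oppr_inj TD.
  have {}TD : T (D Y) = D (T Y).
    apply/matrixP => p q; apply/eqP; rewrite -subr_eq0.
    by move/matrixP: TD => /(_ p q)/eqP; rewrite !mulmxnE -subr_eq0 -mulrnBl mulrn_eq0.
  transitivity (T (D Y) - D (T Y)); last by rewrite TD subrr.
  rewrite /T /D mulmx_suml mulmx_sumr -!sumrB; apply: eq_bigr => i _.
  rewrite !(rep_br repr) !(mulmxBr, mulmxBl) !mulmxA.
  by apply/matrixP => p q; rewrite !mxE; ring.
have perp z : (forall w, w \in h -> B w z = 0) -> z = 0.
  move=> zh.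
  (* [tensor_form_eq0] with [e' i = br x (e i)] kills [\sum_i B (br x (e i)) z *: e i], whose
     pairing with [w] is [B (br x w) z]. *)
  have b0 x w : w \in h -> B (br x w) z = 0.
    move=> wh; case: frE => _ /(_ w wh) ->.
    rewrite (br_sumr lieV) (form_suml formB).
    have : B w (\sum_i B (br x (e i)) z *: e i) = 0.
      rewrite (tensor_form_eq0 (T0 x)) => [|i]; last exact: zh.
      by rewrite (formC formB) (form0l formB).
    rewrite (form_sumr formB) => {2}<-; apply: eq_bigr => i _.
    by rewrite (brZr lieV) (formZl formB) (formZr formB) mulrC.
  (* By [b0] and invariance, [[z, w]] is orthogonal to every [y]; so [z] commutes with [h], and by
     [inv] with all of [V]. *)
  apply: (central_eq0 lieV ssV) => x; apply: inj_phi; rewrite (rep0 lieV repr).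
  rewrite (rep_br repr) (inv (phi z)) ?subrr // => w wh.
  apply/eqP; rewrite -subr_eq0 -(rep_br repr).
  suff -> : br z w = 0 by rewrite (rep0 lieV repr).
  apply: (form_eq0 formB) => y; rewrite (brC lieV) (formNr formB) (formC formB).
  by rewrite (form_br formB) (brC lieV) (formNr formB) (formC formB) b0 ?oppr0.
apply/vspaceP => x; rewrite memvf.
have [y yh xy] := orth_proj formB h x.
by have /eqP := perp _ xy; rewrite subr_eq0 => /eqP ->.
Qed.

End Invariants.


(** * The tensor product with the dual *)

Section TensorVec.
Variables (F : comPzRingType) (n : nat).

(** Vectorisation in the index order of the Kronecker product [*t]. *)
Definition tens_vec (Y : 'M[F]_n) : 'rV[F]_(n * n) :=
  \row_k Y (mxtens_unindex k).1 (mxtens_unindex k).2.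

Lemma tens_vec_surj (v : 'rV[F]_(n * n)) : exists Y, v = tens_vec Y.
Proof.
exists (\matrix_(i, j) v 0 (mxtens_index (i, j))); apply/rowP => k.
by rewrite !mxE -surjective_pairing mxtens_unindexK.
Qed.

Lemma tens_vec_inj : injective tens_vec.
Proof.
move=> X Y /rowP XY; apply/matrixP => i j.
by have := XY (mxtens_index (i, j)); rewrite !mxE mxtens_indexK.
Qed.

Lemma tens_vecP a (X Y : 'M[F]_n) :
  tens_vec (a *: X + Y) = a *: tens_vec X + tens_vec Y.
Proof. by apply/rowP => k; rewrite !mxE. Qed.

Lemma tens_vecB (X Y : 'M[F]_n) : tens_vec (X - Y) = tens_vec X - tens_vec Y.
Proof. by apply/rowP => k; rewrite !mxE. Qed.

Lemma eq_mul_tens_vec m (M1 M2 : 'M[F]_(n * n, m)) :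
  (forall Y, tens_vec Y *m M1 = tens_vec Y *m M2) -> M1 = M2.
Proof.
move=> eqM; apply/row_matrixP => i; rewrite !rowE.
by have [Y ->] := tens_vec_surj (delta_mx 0 i).
Qed.

(** The tensor product with the dual is the commutator action on matrices, so its invariants are the
    commutant. *)
Lemma tens_vec_mul (A Y : 'M[F]_n) :
  tens_vec Y *m (A *t (1%:M : 'M_n) + (1%:M : 'M_n) *t (- A^T))^T =
  tens_vec (A *m Y - Y *m A).
Proof.
apply/rowP => k; rewrite -[k]mxtens_unindexK; case: (mxtens_unindex k) => a b.
rewrite !mxE mxtens_indexK /=.
rewrite (reindex (@mxtens_index n n)) /=; last first.
  by exists (@mxtens_unindex n n) => p _; rewrite ?mxtens_indexK ?mxtens_unindexK.
transitivity (\sum_(p : 'I_n * 'I_n)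
    (Y p.1 p.2 * (A a p.1 * (b == p.2)%:R) - Y p.1 p.2 * ((a == p.1)%:R * A p.2 b))).
  apply: eq_bigr => -[i j] _ /=; rewrite mxE mxtens_indexK /= [X in _ * X]mxE.
  by rewrite [X in _ * X]mxE !tensmxE !mxE mulrN mulrDr mulrN.
rewrite -(pair_bigA _ (fun i j => Y i j * (A a i * (b == j)%:R) - Y i j * ((a == i)%:R * A j b))) /=.
under eq_bigr do rewrite sumrB.
rewrite sumrB; congr (_ - _).
  apply: eq_bigr => i _; rewrite (bigD1 b) //= eqxx mulr1 big1 ?addr0 1?mulrC //.
  by move=> j /negPf jb; rewrite eq_sym jb !mulr0.
rewrite (bigD1 a) //= [X in _ + X]big1 ?addr0 => [|i /negPf ia].
  by apply: eq_bigr => j _; rewrite eqxx mul1r.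
by rewrite big1 // => j _; rewrite eq_sym ia mul0r mulr0.
Qed.

End TensorVec.

Section TensorAd.
Variables (F : fieldType) (n : nat).

(* Up to sign, the transpose of [phi x] tensored with the dual: rows are acted
   upon by transposes, which reverse brackets. *)
Definition tens_ad (A : 'M[F]_n) : 'M[F]_(n * n) :=
  - (A *t (1%:M : 'M_n) + (1%:M : 'M_n) *t (- A^T))^T.

Lemma mul_tens_vec_ad Y A : tens_vec Y *m tens_ad A = tens_vec (Y *m A - A *m Y).
Proof.
rewrite mulmxN tens_vec_mul; apply/rowP => k; rewrite !mxE.
by rewrite opprB.
Qed.

Lemma tens_adD a (A A' : 'M[F]_n) :
  tens_ad (a *: A + A') = a *: tens_ad A + tens_ad A'.
Proof.
apply: eq_mul_tens_vec => Y.
rewrite [RHS]mulmxDr -[in RHS]scalemxAr !mul_tens_vec_ad -tens_vecP.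
congr tens_vec; rewrite mulmxDr mulmxDl -scalemxAr -scalemxAl scalerBr.
by rewrite opprD addrACA.
Qed.

Lemma tens_adM (A A' : 'M[F]_n) :
  tens_ad (A *m A' - A' *m A) = tens_ad A *m tens_ad A' - tens_ad A' *m tens_ad A.
Proof.
apply: eq_mul_tens_vec => Y.
rewrite [RHS]mulmxBr !(mulmxA (tens_vec Y)) !mul_tens_vec_ad.
rewrite -tens_vecB; congr tens_vec.
rewrite !(mulmxBr, mulmxBl) !mulmxA.
move: (Y *m A *m A') (Y *m A' *m A) (A *m A' *m Y) (A' *m A *m Y) => M1 M2 M3 M4.
move: (A *m Y *m A') (A' *m Y *m A) => M5 M6.
by apply/matrixP => i j; rewrite !mxE; ring.
Qed.

End TensorAd.

(** Rules out the value 0, which [norm1] also takes by default. *)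
Lemma girr_decomp_gt0 (F : fieldType) N G k (U : 'I_k -> 'M[F]_N) :
  (0 < N)%N -> girr_decomp G U 1%:M -> (0 < k)%N.
Proof.
move=> N0 [_ _ e1]; rewrite lt0n; apply/eqP => k0.
have := mxrank1 F N; rewrite -e1; have -> : (\sum_i U i)%MS = 0.
  by apply: big1 => i; have := ltn_ord i; rewrite [X in (_ < X)%N]k0.
by rewrite mxrank0 => N_0; rewrite -N_0 in N0.
Qed.

(** * Comparison of the lengths under [h] and under the whole algebra *)

Section Core.
Variables (R : realType) (V : vectType R) (br : V -> V -> V) (B : V -> V -> R).
Hypothesis lieV : is_lie_bracket br.
Hypothesis ssV : lie_semisimple br.
Hypothesis formB : invariant_form br B.
Variables (C : numClosedFieldType) (f : {rmorphism R -> C}).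
Hypothesis f_real : forall a, f a \is Num.real.
Variables re im : C -> R.
Hypothesis reim : forall c, c = f (re c) + 'i * f (im c).
Variables (n : nat) (phi : V -> 'M[C]_n).
Hypothesis repr : is_rep_along br f phi.
Hypothesis inj_phi : injective phi.

Let rho x := tens_ad (phi x).

Lemma is_rep_along_tens_ad : is_rep_along br f rho.
Proof.
have [lin brk] := repr.
by split=> *; rewrite /rho ?lin ?brk ?tens_adD ?tens_adM.
Qed.

Lemma tens_ad_decomp_exists :
  exists k U, @girr_decomp C _ (rep_range fullv rho) k U 1%:M.
Proof.
apply: girr_decomp_exists; last exact: gstable1.
exact: (weyl lieV ssV formB f_real is_rep_along_tens_ad).
Qed.

Lemma equal_length_full (h : {vspace V}) k (U W : 'I_k -> 'M[C]_(n * n)) :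
  lie_subalgebra br h -> girr_decomp (rep_range fullv rho) U 1%:M ->
  girr_decomp (rep_range h rho) W 1%:M -> h = fullv.
Proof.
move=> subh dU dW; have repT := is_rep_along_tens_ad.
have hU : girr_decomp (rep_range h rho) U 1%:M.
  apply: girr_decomp_restrict dW dU => A [x xh ->].
  by exists x => //; apply: memvf.
have [m [e frE]] := frame_exists formB h.
have tens_vec0 : tens_vec (0 : 'M[C]_n) = 0 by apply/rowP => i; rewrite !mxE.
apply: (subalgebra_full_criterion lieV ssV formB repr inj_phi reim subh frE) => Y.
  (* Commuting with [phi] on [h] means that [tens_vec Y] is an [h]-invariant vector of [rho]. *)
  move=> Yh x; apply/eqP; rewrite -subr_eq0; apply/eqP; apply: tens_vec_inj.
  rewrite -mul_tens_vec_ad tens_vec0.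
  apply: (invariants_restrict lieV ssV formB repT dU hU) => w wh.
  by rewrite mul_tens_vec_ad Yh // subrr tens_vec0.
move=> x ad.
pose Z := casimir e rho.
have vecZ X : tens_vec X *m Z =
    tens_vec (\sum_i ad (phi (e i)) (ad (phi (e i)) X)).
  rewrite mulmx_sumr; under eq_bigr do rewrite mulmxA !mul_tens_vec_ad.
  rewrite (big_morph (@tens_vec _ _) (id1 := 0) (op1 := +%R)) //.
  by move=> M N; have := tens_vecP 1 M N; rewrite !scale1r.
(* Schur's lemma applies to [h] because [hU] keeps each [U i] irreducible under [h]. *)
have /boolp.choice[c cU] : forall i, exists a, U i *m Z = a *: U i.
  move=> i; have [irrU _ _] := hU.
  apply: (girreducible_scalar (irrU i)).
    by move=> _ [w wh ->]; rewrite (casimir_comm lieV formB repT frE subh wh).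
  have [sU _ _] := irrU i; rewrite mulmx_sumr summx_sub // => j _.
  have ej : rep_range h rho (rho (e j)) by exists (e j) => //; case: frE.
  by rewrite mulmxA; apply: submx_trans (submxMr _ (sU _ ej)) (sU _ ej).
have ZC : rho x *m Z = Z *m rho x.
  by apply: (girr_decomp_commute dU cU); exists x => //; apply: memvf.
apply: tens_vec_inj; rewrite -vecZ -[ad (phi x) _ in RHS]/(_ - _).
rewrite -[in RHS]mul_tens_vec_ad -vecZ -mulmxA -/(rho x) -ZC mulmxA.
by rewrite mul_tens_vec_ad.
Qed.

End Core.

(** The two actions differ by a transpose, already present in [rep_invariant], and a sign, which
    leaves row spaces unchanged. *)
Lemma has_irr_decompP (R : realType) (V : vectType R) (n : nat)
    (phi : V -> 'M[R[i]]_n) (S : {vspace V}) k :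
  has_irr_decomp S (tensor_rep phi (dual_rep phi)) k <->
  exists U : 'I_k -> 'M[R[i]]_(n * n),
    girr_decomp (rep_range (C := R[i]) S (fun x => tens_ad (phi x))) U 1%:M.
Proof.
have st U : rep_invariant S (tensor_rep phi (dual_rep phi)) U <->
    gstable (rep_range (C := R[i]) S (fun x => tens_ad (phi x))) U.
  split=> [sU _ [x xS ->]|sU x xS].
    by rewrite mulmxN eqmx_opp; apply: sU.
  have := sU _ (ex_intro2 _ _ x xS erefl).
  by rewrite mulmxN eqmx_opp.
split=> -[U [irrU dU eU]]; exists U; split=> // i; have [sU U0 minU] := irrU i.
  by split=> // [|W /st]; [apply/st | apply: minU].
by split=> // [|W /st]; [apply/st | apply: minU].
Qed.

Theorem theorem7 (R : realType) (V : vectType R) (br : V -> V -> V)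
    (h : {vspace V}) (n : nat) (phi : V -> 'M[R[i]]_n) :
  is_lie_bracket br -> lie_semisimple br -> lie_compact br ->
  lie_subalgebra br h ->
  is_lie_rep br phi -> faithful_rep phi ->
  (h = fullv <->
   norm1 h (tensor_rep phi (dual_rep phi)) =
   norm1 fullv (tensor_rep phi (dual_rep phi))).
Proof.
move=> lieV ssV [B formB] subh repr inj; split=> [->//|eqn].
pose C : numClosedFieldType := R[i].
pose f : {rmorphism R -> C} := real_complex R.
have f_real a : f a \is Num.real by rewrite realE !lecR; apply: num_real.
have reim (c : C) : c = f (complex.Re c) + 'i * f (complex.Im c).
  by rewrite [LHS]complexE complexiE.
(* In dimension 0 the length 0 cannot be told from the default value; there faithfulness forces [V]
   to be trivial. *)
have [n0|n0] := posnP n.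
  have V0 (x : V) : x = 0.
    by apply: inj; move: (phi x) (phi 0); rewrite n0 => M N; rewrite [M]thinmx0 [N]thinmx0.
  by apply/vspaceP => x; rewrite memvf (V0 x) mem0v.
have repC : is_rep_along br f (phi : V -> 'M[C]_n) by exact: repr.
set psi := tensor_rep _ _ in eqn.
have [k [U dU]] := tens_ad_decomp_exists lieV ssV formB f_real repC.
have full_dec : has_irr_decomp fullv psi (norm1 fullv psi).
  by apply: (xgetPex 0%N); exists k; apply/has_irr_decompP; exists U.
have /has_irr_decompP[U1 dU1] := full_dec.
(* A positive value of [norm1] is not the default, so a decomposition under [h] exists; complete
   reducibility under [h] follows from the equality of norms. *)
have k_gt0 : (0 < norm1 h psi)%N.
  by rewrite eqn; apply: girr_decomp_gt0 dU1; rewrite muln_gt0 n0.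
have h_dec : has_irr_decomp h psi (norm1 h psi).
  apply: (xgetPex 0%N); apply: contrapT => nex.
  by move: k_gt0; rewrite /norm1 xgetPN // => k' ?; apply: nex; exists k'.
move/has_irr_decompP: h_dec => [W dW]; rewrite -eqn in U1 dU1.
exact: (equal_length_full lieV ssV formB reim repC inj subh dU1 dW).
Qed.
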